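(* Let $L\subseteq\mathbb{R}^n$ be a linear subspace, let $x_0,c\in\mathbb{R}^n$, and let $L':=L+x_0$. Let $x^k$ be on the central path of the linear program $$\min\ c^\top x\quad\text{s.t. } x\in L',\ x\in\mathbb{R}^n_+ ,$$ and let $X_k$ denote the diagonal matrix whose diagonal entries are the components of $x^k$. Let $p\in\mathbb{R}^n$ be any vector such that $$\|X_k p\|_2<\frac{1}{n+2\sqrt{n}+1}\cdot\big\|P_{X_k^{-1}\cdot L}(X_k c)\big\|_2 .$$ Then for any optimal solution $\hat{x}$ of the perturbed problem $$\min\ (c+p)^\top x\quad\text{s.t. } x\in L',\ x\in\mathbb{R}^n_+ ,$$ it holds that $c^\top\hat{x}\le c^\top x^k$.
   Context: $\mathbb{R}^n_+$ is the nonnegative orthant. $X_k^{-1}\cdot L:=\{X_k^{-1}v: v\in L\}$, and $P_{\mathcal{X}}(z):=\arg\min_{\hat z\in\mathcal{X}}\|z-\hat z\|$ is the Euclidean projection onto $\mathcal{X}$. Central path: a point $x$ is on the central path of $\min\{c^\top x: x\in L+x_0,\ x\in\mathbb{R}^n_+\}$ if $x$ is feasible and there exist $\mu>0$ and a dual feasible slack $s$, i.e. $s\in c+L^\perp$ with $s\ge 0$ (where $L^\perp$ is the orthogonal complement of $L$), such that $x_is_i=\mu$ for all $i=1,\dots,n$; in particular $x>0$ and $s>0$ componentwise. (When the feasible set is $\{x: Ax=b,\ x\ge0\}$, so that $L=\operatorname{Null}(A)$, the condition $s\in c+L^\perp$ says that $A^\top y+s=c$ for some $y$.) Standing assumption: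 the linear program and its dual are both strictly feasible, i.e. there are a strictly positive $x\in L'$ and a strictly positive $s\in c+L^\perp$. *)

(* Defs.v *)
(* [R : realType] plays the role of the real numbers; vectors of R^n are column
   vectors ['cV[R]_n]. *)
From HB Require Import structures.
From mathcomp Require Import all_boot all_order all_algebra.
From mathcomp Require Import boolp classical_sets reals.

Set Implicit Arguments.
Unset Strict Implicit.
Unset Printing Implicit Defensive.

Import Order.TTheory GRing.Theory Num.Theory.

Local Open Scope classical_set_scope.
Local Open Scope ring_scope.

Section LinearProgram.
Variables (R : realType) (n : nat).
Implicit Types (A : set 'cV[R]_n) (L : {vspace 'cV[R]_n}) (c s u v x z : 'cV[R]_n).

Definition dot u v : R := \sum_(i < n) u i 0 * v i 0.

(* The norm that MathComp-Analysis puts on matrices is the sup norm, hence this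
   separate Euclidean norm. *)
Definition norm2 u : R := Num.sqrt (dot u u).

Definition nonneg u : Prop := forall i, 0 <= u i 0.

Definition strictly_pos u : Prop := forall i, 0 < u i 0.

Definition affine L u : set 'cV[R]_n := [set v + u | v in [set` L]].

Definition orthocomp L : set 'cV[R]_n :=
  [set s | forall v, v \in L -> dot s v = 0].

Definition is_argmin_dist A z v : Prop :=
  A v /\ forall w, A w -> norm2 (z - v) <= norm2 (z - w).

(* A nearest point of [A] to [z]; for a linear subspace [A] it exists and is
   unique. The value is 0 if there is no nearest point. *)
Definition proj A z : 'cV[R]_n := xget 0 [set v | is_argmin_dist A z v].

Definition diag_of x : 'M[R]_n := diag_mx x^T.

Definition rescaled L x : set 'cV[R]_n :=
  [set invmx (diag_of x) *m v | v in [set` L]].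

Definition primal_feasible L x0 : set 'cV[R]_n :=
  [set x | affine L x0 x /\ nonneg x].

Definition dual_slack L c : set 'cV[R]_n :=
  [set c + v | v in orthocomp L].

Definition dual_feasible L c : set 'cV[R]_n :=
  [set s | dual_slack L c s /\ nonneg s].

Definition optimal L x0 c x : Prop :=
  primal_feasible L x0 x /\
  forall y, primal_feasible L x0 y -> dot c x <= dot c y.

Definition on_central_path L x0 c x : Prop :=
  primal_feasible L x0 x /\
  exists mu : R, 0 < mu /\
    exists s, dual_feasible L c s /\ forall i, x i 0 * s i 0 = mu.

End LinearProgram.

(* Main.v *)
Require Import Defs.
From HB Require Import structures.
From mathcomp Require Import all_boot all_order all_algebra.
From mathcomp Require Import boolp classical_sets reals.
From mathcomp Require Import ring lra.

Set Implicit Arguments.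
Unset Strict Implicit.
Unset Printing Implicit Defensive.

Import Order.TTheory GRing.Theory Num.Theory.
Local Open Scope ring_scope.

(** Rescale by the inverse of X_k, so that the central point becomes the all-ones
    vector e.  Write b = X_k c, q = X_k p, M = X_k^-1 L, and let v be the
    projection of b onto M, with norm beta.  Centrality says that on M the cost b
    is mu times the sum of the coordinates.

    The unit ball around e lies in the orthant, so e - v / beta is feasible, and
    its cost is lower than that of e by beta.  Suppose that an optimum e + d of
    the perturbed problem had a larger unperturbed cost than e.  The segment from
    e - v / beta to e + d then meets the level set of e at some point e + w.  By
    linearity e + w is, for the cost b + q, at least as good as e - v / beta, so
    beta <= |q| (|w| + 1).  Moreover e + w is nonnegative and its coordinates sum
    to n, as w has coordinate sum 0; hence |w| <= n ([norm2_zero_sum_le]) and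
    beta <= |q| (n + 1), which contradicts the bound on q.  This is
    [rescaled_cost_le0].

    Of the projection only the orthogonality of b - v to M is used
    ([argmin_dist_orthogonal]); a nearest point exists here because the projection
    would otherwise be 0, and the hypothesis on p makes it nonzero. *)

Section EuclideanProduct.
Variables (R : realType) (n : nat).
Implicit Types u v w : 'cV[R]_n.

Lemma dotC u v : dot u v = dot v u.
Proof. by apply: eq_bigr => i _; rewrite mulrC. Qed.

Lemma dotDl u v w : dot (u + v) w = dot u w + dot v w.
Proof. by rewrite -big_split; apply: eq_bigr => i _; rewrite mxE mulrDl. Qed.

Lemma dotZl a u w : dot (a *: u) w = a * dot u w.
Proof. by rewrite mulr_sumr; apply: eq_bigr => i _; rewrite mxE mulrA. Qed.

Lemma dotDr u v w : dot w (u + v) = dot w u + dot w v.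
Proof. by rewrite dotC dotDl !(dotC w). Qed.

Lemma dotZr a u w : dot w (a *: u) = a * dot w u.
Proof. by rewrite dotC dotZl dotC. Qed.

Lemma dotNl u w : dot (- u) w = - dot u w.
Proof. by rewrite -scaleN1r dotZl mulN1r. Qed.

Lemma dotNr u w : dot w (- u) = - dot w u.
Proof. by rewrite dotC dotNl dotC. Qed.

Definition dotE := (dotDl, dotDr, dotZl, dotZr, dotNl, dotNr).

Lemma dot_ge0 u : 0 <= dot u u.
Proof. by apply: sumr_ge0 => i _; rewrite -expr2 sqr_ge0. Qed.

Lemma norm2_ge0 u : 0 <= norm2 u.
Proof. exact: sqrtr_ge0. Qed.

Lemma sqr_norm2 u : norm2 u ^+ 2 = dot u u.
Proof. by rewrite sqr_sqrtr ?dot_ge0. Qed.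

Lemma norm2_0 : norm2 (0 : 'cV[R]_n) = 0.
Proof. by rewrite /norm2 /dot big1 ?sqrtr0 // => i _; rewrite mxE mul0r. Qed.

Lemma norm2_le u a : 0 <= a -> (norm2 u <= a) = (dot u u <= a ^+ 2).
Proof. by move=> a0; rewrite -sqr_norm2 ler_pXn2r ?nnegrE ?norm2_ge0. Qed.

Lemma coord_le_norm2 u i : u i 0 <= norm2 u.
Proof.
apply: le_trans (ler_norm _) _.
rewrite -(ler_pXn2r (n := 2)) ?nnegrE ?norm2_ge0 // real_normK ?num_real //.
rewrite sqr_norm2 /dot (bigD1 i) //= expr2 lerDl.
by apply: sumr_ge0 => j _; rewrite -expr2 sqr_ge0.
Qed.

Lemma cauchy_schwarz u v : dot u v <= norm2 u * norm2 v.
Proof.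
have [u0 v0] := (norm2_ge0 u, norm2_ge0 v).
have [su sv] := (sqr_norm2 u, sqr_norm2 v).
set a := norm2 u in u0 su *; set b := norm2 v in v0 sv *.
have [P|] := ltP 0 (a * b).
  have := dot_ge0 (b *: u - a *: v).
  rewrite !dotE (dotC v u) -su -sv => H.
  rewrite -(ler_pM2l P); nra.
(* When one factor has norm 0 it is the zero vector, and the product vanishes. *)
move=> ab0; have /eqP : a * b = 0 by apply: le_anti; rewrite ab0 mulr_ge0.
have norm0 (w : 'cV[R]_n) : norm2 w = 0 -> forall i, w i 0 = 0.
  move=> w0 i; apply: le_anti; rewrite -{1}w0 coord_le_norm2 /=.
  have := coord_le_norm2 (- w) i; rewrite mxE /norm2 dotNl dotNr opprK.
  by rewrite -[Num.sqrt _]/(norm2 w) w0 oppr_le0.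
rewrite mulf_eq0 => /orP[] /eqP /norm0 E.
  by rewrite /dot big1 ?mulr_ge0 // => i _; rewrite E mul0r.
by rewrite /dot big1 ?mulr_ge0 // => i _; rewrite E mulr0.
Qed.

Lemma sum_sqr_le_sqr_sum u : nonneg u ->
  dot u u <= (\sum_(i < n) u i 0) ^+ 2.
Proof.
move=> u0; rewrite expr2 mulr_suml; apply: ler_sum => i _.
by rewrite ler_wpM2l // (bigD1 i) //= lerDl sumr_ge0.
Qed.

Lemma norm2N u : norm2 (- u) = norm2 u.
Proof. by rewrite /norm2 !dotE opprK. Qed.

(** The vector [const_mx 1 + w] is a point of the simplex of coordinate sum [n],
    so its Euclidean norm is at most [n]; the distance from the centroid is no
    larger. *)
Lemma norm2_zero_sum_le w : (forall i, -1 <= w i 0) ->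
  \sum_(i < n) w i 0 = 0 -> norm2 w <= n%:R.
Proof.
move=> wge w0; rewrite norm2_le ?ler0n //.
have := @sum_sqr_le_sqr_sum (const_mx 1 + w).
have sum1 : \sum_(i < n) (1 : R) = n%:R by rewrite sumr_const card_ord.
have -> : \sum_(i < n) (const_mx 1 + w) i 0 = n%:R.
  under eq_bigr do rewrite !mxE.
  by rewrite big_split /= w0 addr0.
have -> : dot (const_mx 1 + w) (const_mx 1 + w) = n%:R + dot w w.
  have -> : n%:R + dot w w = \sum_(i < n) 1 + 2 * \sum_(i < n) w i 0 + dot w w.
    by rewrite w0 sum1 mulr0 addr0.
  rewrite mulr_sumr -!big_split; apply: eq_bigr => i _ /=; rewrite !mxE; ring.
move=> H; apply: le_trans (H _); first by rewrite lerDr ler0n.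
by move=> i; rewrite !mxE -lerBlDl sub0r.
Qed.

(** Only the fact that [A] contains the line through [v] in direction [w] is
    needed. *)
Lemma argmin_dist_orthogonal (A : set 'cV[R]_n) z v w : is_argmin_dist A z v ->
  (forall t, A (v + t *: w)) -> dot (z - v) w = 0.
Proof.
move=> [_ vmin] Aw.
have W0 := dot_ge0 w.
(* Up to the + 1, which keeps the denominator positive, this step t minimizes
   |z - v - t w|^2. *)
have [t tW] : exists t, t * (dot w w + 1) = dot (z - v) w.
  by exists (dot (z - v) w / (dot w w + 1)); rewrite divfK // lt0r_neq0 // ltr_wpDl.
have := vmin _ (Aw t).
rewrite opprD addrA norm2_le ?norm2_ge0 // sqr_norm2 -tW.
move: (z - v) tW => r tW; rewrite !dotE (dotC w r) -tW => H.
have t0 : t = 0.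
  by apply/eqP; rewrite -sqrf_eq0; apply/eqP/le_anti; rewrite sqr_ge0 andbT; nra.
by rewrite t0 mul0r.
Qed.

(** The argument around the all-ones vector e.  The hypotheses on [b], [v] and
    [d] are what centrality and the projection give in rescaled coordinates; the
    feasible points e + d and e - v / |v| are represented by their differences
    to e, and e + d is at least as good as the other for the cost [b + q]. *)
Lemma rescaled_cost_le0 (b q v d : 'cV[R]_n) (mu : R) : 0 < mu ->
    dot b v = mu * \sum_(i < n) v i 0 -> dot b d = mu * \sum_(i < n) d i 0 ->
    dot b v = dot v v -> (forall i, -1 <= d i 0) ->
    dot (b + q) d <= dot (b + q) (- ((norm2 v)^-1 *: v)) ->
    norm2 q * (n%:R + 1) < norm2 v ->
  dot b d <= 0.
Proof.
move=> mu0 bv bd bvv d_ge opt hq.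
have q0 := norm2_ge0 q; have nv2 := sqr_norm2 v.
have v_le i := coord_le_norm2 v i.
have cs_qv := cauchy_schwarz (- q) v; rewrite norm2N dotNl in cs_qv.
set beta := norm2 v in opt hq nv2 v_le cs_qv.
have beta0 : 0 < beta by apply: le_lt_trans hq; rewrite mulr_ge0 // addr_ge0.
rewrite leNgt; apply/negP => alpha0.
set alpha := dot b d in alpha0 bd.
have ab0 : alpha + beta != 0 by rewrite lt0r_neq0 // addr_gt0.
have beta_neq0 : beta != 0 by rewrite lt0r_neq0.
pose t := beta / (alpha + beta).
have t0 : 0 < t by rewrite divr_gt0 // addr_gt0.
have t1 : t < 1 by rewrite ltr_pdivrMr ?addr_gt0 // mul1r ltrDr.
(* The point of the segment from - v / beta to d where the cost b vanishes. *)
pose w := t *: d - (1 - t) *: (beta^-1 *: v).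
have bw0 : dot b w = 0.
  by rewrite /w !dotE -/alpha bvv -nv2 /t; field; rewrite ab0 beta_neq0.
have w_sum : \sum_(i < n) w i 0 = 0.
  apply: (mulfI (lt0r_neq0 mu0)); rewrite mulr0 -[RHS]bw0.
  have -> : \sum_(i < n) w i 0 =
      t * (\sum_(i < n) d i 0) - (1 - t) * (beta^-1 * \sum_(i < n) v i 0).
    by rewrite !mulr_sumr -sumrB; apply: eq_bigr => i _; rewrite !mxE.
  by rewrite /w !dotE bv -/alpha bd; ring.
have w_ge i : -1 <= w i 0.
  have vb : beta^-1 * v i 0 <= 1 by rewrite mulrC ler_pdivrMr // mul1r.
  have := d_ge i; rewrite !mxE; nra.
have w_le := norm2_zero_sum_le w_ge w_sum.
have cs_qw := cauchy_schwarz (- q) w; rewrite norm2N dotNl in cs_qw.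
have {}cs_qw : - dot q w <= norm2 q * n%:R.
  by apply: le_trans cs_qw _; rewrite ler_wpM2l.
have {}cs_qv : - (beta^-1 * dot q v) <= norm2 q.
  by rewrite -mulrN mulrC ler_pdivrMr.
have bvb : beta^-1 * dot b v = beta by rewrite bvv -nv2 expr2 mulKf.
(* w is a convex combination of d and - v / beta, so opt passes to w. *)
have opt_w : dot b w + dot q w <= - beta - beta^-1 * dot q v.
  by move: opt; rewrite /w !dotE bvb; nra.
by move: opt_w hq; rewrite bw0; lra.
Qed.

End EuclideanProduct.

Section Rescaling.
Variables (R : realType) (n : nat).
Implicit Types u v w x : 'cV[R]_n.

Lemma diag_of_mulE x u i : (diag_of x *m u) i 0 = x i 0 * u i 0.
Proof. by rewrite /diag_of mul_diag_mx !mxE. Qed.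

Lemma dot_diag_of x u v : dot (diag_of x *m u) v = dot u (diag_of x *m v).
Proof. by apply: eq_bigr => i _; rewrite !diag_of_mulE mulrCA mulrA. Qed.

Lemma diag_of_unit x : strictly_pos x -> diag_of x \in unitmx.
Proof.
move=> x0; rewrite unitmxE det_diag unitfE; apply/prodf_neq0 => i _.
by rewrite mxE lt0r_neq0.
Qed.

(** Rescaling by a central point turns the cost of a direction of [L] into [mu]
    times the sum of its coordinates: [c] and the dual slack [s]
    differ by an element of the orthogonal complement, and [x_i s_i = mu]. *)
Lemma central_cost (L : {vspace 'cV[R]_n}) c s x mu u :
    dual_slack L c s -> (forall i, x i 0 * s i 0 = mu) ->
    diag_of x *m u \in L ->
  dot (diag_of x *m c) u = mu * \sum_(i < n) u i 0.
Proof.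
move=> [l lL <-] xs uL; rewrite dot_diag_of.
have -> : dot c (diag_of x *m u) = dot (c + l) (diag_of x *m u).
  by rewrite dotDl (lL _ uL) addr0.
rewrite mulr_sumr; apply: eq_bigr => i _.
by rewrite diag_of_mulE mulrA (mulrC _ (x i 0)) xs.
Qed.

End Rescaling.

Theorem theorem1 (R : realType) (n : nat) (L : {vspace 'cV[R]_n})
    (x0 c xk p : 'cV[R]_n)
    (hprimal : exists x, affine L x0 x /\ strictly_pos x)
    (hdual : exists s, dual_slack L c s /\ strictly_pos s)
    (hxk : on_central_path L x0 c xk)
    (hp : norm2 (diag_of xk *m p)
          < 1 / (n%:R + 2 * Num.sqrt (n%:R : R) + 1)
            * norm2 (proj (rescaled L xk) (diag_of xk *m c))) :
  forall xhat : 'cV[R]_n, optimal L x0 (c + p) xhat -> dot c xhat <= dot c xk.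
Proof.
move=> xhat [[[lh lhL xhatE] xhat0] xhat_min].
have [[[lk lkL xkE] xk0] [mu [mu0 [s [[sL _] xs]]]]] := hxk.
have xk_pos : strictly_pos xk.
  move=> i; rewrite lt_neqAle xk0 andbT eq_sym; apply/eqP => xki.
  by move: mu0; rewrite -(xs i) xki mul0r ltxx.
have D_unit := diag_of_unit xk_pos.
set D := diag_of xk in hp D_unit; set v := proj _ _ in hp.
have sqrt0 := sqrtr_ge0 (n%:R : R); have n0 := ler0n R n.
have den0 : 0 < n%:R + 2 * Num.sqrt (n%:R : R) + 1 by lra.
(* (sqrt n + 1)^2 is only used through the lower bound n + 1. *)
have {}hp : norm2 (D *m p) * (n%:R + 1) < norm2 v.
  move: hp; rewrite mul1r mulrC ltr_pdivlMr //; apply: le_lt_trans.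
  by rewrite ler_wpM2l ?norm2_ge0 //; lra.
have v_pos : 0 < norm2 v.
  by apply: le_lt_trans hp; rewrite mulr_ge0 ?norm2_ge0 ?addr_ge0.
have v_min : is_argmin_dist (rescaled L xk) (D *m c) v.
  (* The default value 0 of the projection is excluded by v_pos. *)
  move: v_pos; rewrite /v /proj; case: xgetP => // _.
  by rewrite norm2_0 ltxx.
have [[lv lvL vE] _] := v_min.
have DvL : D *m v \in L by rewrite -vE mulKVmx.
pose d := invmx D *m (xhat - xk).
have Dd : D *m d = xhat - xk by rewrite mulKVmx.
have DdL : D *m d \in L.
  by rewrite Dd -xhatE -xkE opprD addrACA subrr addr0 rpredB.
have Dv_orth : dot (D *m c) v = dot v v.
  apply/eqP; rewrite -subr_eq0 -dotNl -dotDl; apply/eqP.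
  apply: argmin_dist_orthogonal v_min _ => t.
  exists (D *m (v + t *: v)); last by rewrite mulKmx.
  by rewrite /= mulmxDr -scalemxAr rpredD ?rpredZ.
have d_ge i : -1 <= d i 0.
  have := xhat0 i; have := diag_of_mulE xk d i; rewrite -/D Dd !mxE => E.
  by have := xk_pos i; nra.
pose z := xk + D *m (- ((norm2 v)^-1 *: v)).
have z_feas : primal_feasible L x0 z.
  split.
    exists (lk + D *m (- ((norm2 v)^-1 *: v))); last by rewrite addrAC xkE.
    by rewrite /= mulmxN -scalemxAr rpredB ?rpredZ.
  move=> i; rewrite mxE diag_of_mulE !mxE.
  have vi : (norm2 v)^-1 * v i 0 <= 1.
    by rewrite mulrC ler_pdivrMr // mul1r coord_le_norm2.
  by have := xk_pos i; nra.
have opt := xhat_min _ z_feas.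
rewrite -subr_le0 -dotNr -dotDr -Dd -dot_diag_of.
apply: (@rescaled_cost_le0 _ _ (D *m c) (D *m p) v d mu) => //.
- exact: central_cost sL xs DvL.
- exact: central_cost sL xs DdL.
rewrite -mulmxDr !dot_diag_of Dd.
by move: opt; rewrite /z dotDr [X in _ -> X <= _]dotDr dotNr; lra.
Qed.
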